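(* Let $X$ be a Banach space with a 1-symmetric and boundedly complete basis. Let $\{x_n\}_{n\in\mathbb{N}}$ be a normalized block sequence in $X$ and assume that there is some $\varepsilon>0$ such that $\|x_n\|_\infty>\varepsilon$ for all $n\in\mathbb{N}$. Then, after passing to an appropriate subsequence of $\{x_n\}$ (still denoted $\{x_n\}$), there exist block sequences $\{y_n\}_{n\in\mathbb{N}}$, $\{z_n\}_{n\in\mathbb{N}}$ in $X$ and a disjointly supported 1-symmetric sequence $\{u_n\}_{n\in\mathbb{N}}$ in $X$ with the following properties: (i) $x_n=y_n+z_n$ for all $n$, and $\operatorname{supp}y_n\cap\operatorname{supp}z_m=\varnothing$ for all $n,m\in\mathbb{N}$; (ii) $\lim_{n\to\infty}\|z_n\|_\infty=0$; (iii) $\{y_n\}_{n\in\mathbb{N}}$ isometrically generates $\{u_n\}_{n\in\mathbb{N}}$ as a spreading model; (iv) $\|u_n\|_\infty=\|u_1\|_\infty>0$ for all $n\in\mathbb{N}$.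
   Context: Spaces are real. For a vector $x=\sum_i x(i)e_i$ expanded with respect to the basis $\{e_i\}$ of $X$, $\operatorname{supp}x=\{i:x(i)\ne0\}$ and $\|x\|_\infty=\sup_i|x(i)|$. A block sequence is a sequence of finitely supported vectors with successive supports; the terms of the block sequences $\{y_n\},\{z_n\}$ are allowed to be zero. A sequence $\{u_n\}$ is 1-symmetric if $\|\sum a_iu_i\|=\|\sum\epsilon_ia_iu_{\pi(i)}\|$ for all finitely supported scalars $(a_i)$, all signs $\epsilon_i=\pm1$ and all permutations $\pi$ of $\mathbb{N}$. The $u_n$ may have infinite supports; disjointly supported means the sets $\operatorname{supp}u_n$ are pairwise disjoint. A bounded sequence $\{y_n\}$ in $X$ (isometrically) generates $\{u_n\}$ as a spreading model if there are positive reals $\delta_n\searrow0$ such that $\big|\,\|\sum_{i=1}^n a_iy_{k_i}\|-\|\sum_{i=1}^n a_iu_i\|\big|<\delta_n$ for every $n$, every $n\le k_1<\dots<k_n$ and every $\{a_i\}_{i=1}^n\subset[-1,1]$. *)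

(* Defs.v *)
From mathcomp Require Import all_boot all_order all_algebra.
From mathcomp Require Import all_classical all_reals all_analysis.
Set Implicit Arguments.
Unset Strict Implicit.
Unset Printing Implicit Defensive.
Import Order.TTheory GRing.Theory Num.Theory.
Import numFieldNormedType.Exports.
Local Open Scope classical_set_scope.
Local Open Scope ring_scope.

(* All sequences are indexed from 0: the term of index n here is the (n+1)-st
   term in the usual numbering by 1, 2, 3, ... *)

Definition is_expansion (R : realType) (X : normedModType R) (e : nat -> X)
    (x : X) (a : nat -> R) : Prop :=
  series (fun i => a i *: e i) @ \oo --> x.

Definition schauder_basis (R : realType) (X : normedModType R)
    (e : nat -> X) : Prop :=
  forall x : X, exists! a : nat -> R, is_expansion e x a.

(* The default value 0 is never used when e is a Schauder basis. *)
Definition coordinates (R : realType) (X : normedModType R) (e : nat -> X)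
    (x : X) : nat -> R :=
  xget (fun=> 0) [set a | is_expansion e x a].

Definition supp (R : realType) (X : normedModType R) (e : nat -> X)
    (x : X) : set nat :=
  [set i | coordinates e x i != 0].

(* [sup] is 0 by convention on unbounded sets; this does not occur when e is a
   1-symmetric Schauder basis, since then the vectors e i have the same nonzero
   norm and the coordinates of any vector tend to 0. *)
Definition coord_supnorm (R : realType) (X : normedModType R) (e : nat -> X)
    (x : X) : R :=
  sup (range (fun i => `|coordinates e x i|)).

Definition boundedly_complete (R : realType) (X : normedModType R)
    (e : nat -> X) : Prop :=
  forall a : nat -> R,
    (exists M : R, forall n, `|series (fun i => a i *: e i) n| <= M) ->
    cvgn (series (fun i => a i *: e i)).

(* The finitely supported scalars are a 0, ..., a n.-1 followed by zeros; the
   sign of index i is (-1) ^+ s i. *)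
Definition one_symmetric (R : realType) (X : normedModType R)
    (u : nat -> X) : Prop :=
  forall (n : nat) (a : nat -> R) (s : nat -> bool) (p : nat -> nat),
    bijective p ->
    `|\sum_(i < n) a i *: u i| = `|\sum_(i < n) ((-1) ^+ s i * a i) *: u (p i)|.

(* Zero terms are allowed, so successiveness is required of all pairs n < m and
   not only of consecutive terms. *)
Definition block_sequence (R : realType) (X : normedModType R) (e : nat -> X)
    (x : nat -> X) : Prop :=
  (forall n, finite_set (supp e (x n))) /\
  (forall n m, (n < m)%N -> forall i j,
     supp e (x n) i -> supp e (x m) j -> (i < j)%N).

Definition disjointly_supported (R : realType) (X : normedModType R)
    (e : nat -> X) (u : nat -> X) : Prop :=
  forall n m, n <> m -> supp e (u n) `&` supp e (u m) = set0.

(* With indices starting at 0, n.+1 vectors y (k 0), ..., y (k n) are taken with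
   n <= k 0 < ... < k n; in the numbering starting at 1 this is
   n.+1 <= (k 0).+1 < ... < (k n).+1. *)
Definition generates_spreading_model (R : realType) (X : normedModType R)
    (y u : nat -> X) : Prop :=
  (exists M : R, forall n, `|y n| <= M) /\
  exists delta : nat -> R,
    [/\ forall n, 0 < delta n,
        forall n m, (n <= m)%N -> delta m <= delta n,
        delta @ \oo --> (0 : R)
      & forall (n : nat) (k : 'I_n.+1 -> nat) (a : 'I_n.+1 -> R),
          (n <= k ord0)%N ->
          (forall i j : 'I_n.+1, (i < j)%N -> (k i < k j)%N) ->
          (forall i, -1 <= a i <= 1) ->
          `| `|\sum_(i < n.+1) a i *: y (k i)|
             - `|\sum_(i < n.+1) a i *: u i| | < delta n].

(* Main.v *)
Require Import Defs.
From mathcomp Require Import all_boot all_order all_algebra.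
From mathcomp Require Import all_classical all_reals all_analysis.
From mathcomp Require Import lra.
Set Implicit Arguments.
Unset Strict Implicit.
Unset Printing Implicit Defensive.
Import Order.TTheory GRing.Theory Num.Theory.
Import numFieldNormedType.Exports.
Local Open Scope classical_set_scope.
Local Open Scope ring_scope.

(** Sort the support of each x_n so that the coordinates decrease in absolute
value, and let c_n(0), c_n(1), ... be the sorted coordinates, padded with zeros.
These profiles are uniformly bounded, so by compactness some subsequence of them
converges coordinatewise to a limit profile b ([pointwise_bounded_cluster]).
Since e is 1-symmetric, the sums of c_n(j) e_j have norm at most |x_n| = 1.
Hence the partial sums of b(j) e_j are bounded, and the series converges because
e is boundedly complete ([exists_limit_profile]).  The largest coordinate of x_n
exceeds eps, so b(0) is not 0.

The vector u_i is a copy of b placed on the i-th row of an injective array of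
positions F i j: u_i is the sum over j of b(j) e_(F i j).  Distinct rows are
disjoint, and permuting or changing the signs of the rows does not affect norms
([spread_one_symmetric]).

For each k take a cutoff m_k beyond which the tails of b are at most
eta_k = (k+1)^-2, and then an index phi(k) at which the first m_k + 1 terms of
the profile differ from those of b by a total of at most eta_k.  The vector y_k
keeps the m_k largest coordinates of x_(phi k), and z_k keeps the others.  The
coordinates of z_k are at most |c_(phi k)(m_k)|, which is within eta_k of
|b(m_k)|, itself bounded by a tail of b; so they tend to 0 uniformly.

For the spreading model, symmetry moves the coordinates of y_(k_0), ...,
y_(k_n), which have disjoint supports, onto rows 0, ..., n of the array without
changing the norm of their combinations ([norm_block_combination]).  In this
position y_(k_i) differs from u_i by at most a constant times eta_(k_i), hence
times eta_n ([dist_spread_le]).  The n+1 errors add up to O((n+1) eta_n) =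
O(1/(n+1)); this is why eta was taken quadratic. *)

(** * Selecting subsequences *)

Lemma ultra_fmap (T U : Type) (f : T -> U) (G : set_system T) :
  UltraFilter G -> UltraFilter (f @ G).
Proof.
move=> G_ultra; split=> [|H H_proper GH]; first exact: fmap_proper_filter.
apply/seteqP; split=> [A HA|]; last exact: GH.
have [//|GA'] := in_ultra_setVsetC (f @^-1` A) G_ultra.
by have [u [? ?]] := @filter_ex _ H _ _ (filterI HA (GH (~` A) GA')).
Qed.

(** Diagonal extraction in the form needed below: along an ultrafilter finer
than the cofinite filter every bounded real sequence converges, so all the
coordinates converge at once, and a set of the ultrafilter meets every tail. *)
Lemma pointwise_bounded_cluster (R : realType) (c : nat -> nat -> R) (C : R) :
  (forall n j, `|c n j| <= C) ->
  exists b : nat -> R, forall (d : R) (m N : nat), 0 < d ->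
    exists n, (N <= n)%N /\ forall j, (j < m)%N -> `|b j - c n j| <= d.
Proof.
move=> cC; have [G [G_ultra infG]] := ultraFilterLemma (F := \oo) _.
have c_cvg j : exists bj : R, c n j @[n --> G] --> bj.
  have Gc : (c n j @[n --> G]) [set` `[- C, C]].
    by apply: (@filterE nat G) => n; rewrite /= in_itv /= -ler_norml; exact: cC.
  have := @segment_compact R (- C) C; rewrite compact_ultra.
  have G_image_ultra : UltraFilter (c n j @[n --> G]) by exact: ultra_fmap.
  by case/(_ _ G_image_ultra Gc) => [bj [_ bjP]]; exists bj.
have [b bP] := choice c_cvg; exists b => d m N d0.
have Gm : \forall n \near G, forall j, (j < m)%N -> `|b j - c n j| <= d.
  elim: m => [|m IH]; first exact: filterE.
  have /cvgrPdist_le/(_ d d0) := bP m; apply: filterS2 IH => n IH cm j.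
  by rewrite ltnS leq_eqVlt => /predU1P[->|/IH].
have GN : \forall n \near G, (N <= n)%N by apply: infG; exists N.
by have [n [? ?]] := filter_ex (filterI GN Gm); exists n.
Qed.

Lemma increasing_selection (P : nat -> nat -> Prop) :
  (forall k N, exists n, (N <= n)%N /\ P k n) ->
  exists phi : nat -> nat, (forall n m, (n < m)%N -> (phi n < phi m)%N) /\
    forall k, P k (phi k).
Proof.
move=> exP; have [g gP] := choice (fun kN => exP kN.1 kN.2).
pose fix phi k := if k is k'.+1 then g (k, (phi k').+1) else g (0%N, 0%N).
exists phi; split; last first.
  by case=> [|k]; [have [] := gP (0%N, 0%N)|have [] := gP (k.+1, (phi k).+1)].
move=> n m; apply: (@homo_ltn _ phi (fun x y => (x < y)%N)).
  by move=> y x z; exact: ltn_trans.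
by move=> k; have [] := gP (k.+1, (phi k).+1).
Qed.

(** * Norms of finite combinations of a symmetric sequence *)

(** One-symmetry speaks of permutations of all of nat, while the arguments below
move finitely many indices; the extension is built by composing with one
transposition for each new index. *)
Lemma partial_injection_extends (N : nat) (f : nat -> nat) :
  (forall i j, (i < N)%N -> (j < N)%N -> f i = f j -> i = j) ->
  exists p : nat -> nat, bijective p /\ forall j, (j < N)%N -> p j = f j.
Proof.
elim: N => [|N IH] finj; first by exists id; split=> //; exists id.
have [i j iN jN|p [p_bij pE]] := IH; first by apply: finj; exact: ltnW.
pose sw i := if i == p N then f N else if i == f N then p N else i.
have swK : involutive sw.
  move=> i; rewrite /sw; case: (eqVneq i (p N)) => [->|ipN].
    by rewrite eqxx; case: eqVneq.
  case: (eqVneq i (f N)) => [->|ifN]; first by rewrite eqxx.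
  by rewrite (negPf ipN) (negPf ifN).
exists (sw \o p); split; first exact: bij_comp (inv_bij swK) p_bij.
move=> j; rewrite ltnS leq_eqVlt => /predU1P[->|jN]; rewrite /= /sw ?eqxx //.
rewrite pE //; case: eqVneq => [|_].
  by rewrite -pE // => /(bij_inj p_bij) jE; rewrite jE ltnn in jN.
case: eqVneq => // /(finj _ _ (ltnW jN) (ltnSn N)) jE.
by rewrite jE ltnn in jN.
Qed.

Section SymmetricSequences.
Context (R : realType) (X : normedModType R) (e : nat -> X).
Hypothesis e_sym : one_symmetric e.

(** Both sides equal the norm of the combination of e 0, e 1, ... with the same
coefficients in the order of [r], since the positions given by [f] or [g] extend
to permutations of nat.  Any index type is allowed, so that double sums are
covered. *)
Lemma norm_sum_reindex (T : Type) (r : seq T) (a : T -> R) (s : T -> bool)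
    (f g : T -> nat) : uniq (map f r) -> uniq (map g r) ->
  `|\sum_(t <- r) a t *: e (f t)|
  = `|\sum_(t <- r) ((-1) ^+ s t * a t) *: e (g t)|.
Proof.
move=> fu gu; case: r fu gu => [|t0 r0]; first by rewrite !big_nil.
set r := t0 :: r0 => fu gu.
(* The boolean b switches the signs on, so that one argument serves both sides. *)
have key (b : bool) (h : T -> nat) : uniq (map h r) ->
    `|\sum_(0 <= j < size r) a (nth t0 r j) *: e j|
    = `|\sum_(t <- r) ((-1) ^+ (b && s t) * a t) *: e (h t)|.
  move=> hu; have [i j iN jN|p [p_bij pE]] :=
    @partial_injection_extends (size r) (fun j => h (nth t0 r j)).
    rewrite -!(nth_map t0 0%N) // => /eqP; rewrite nth_uniq ?size_map //.
    by move/eqP.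
  rewrite big_mkord.
  rewrite (e_sym _ (fun j => a (nth t0 r j)) (fun j => b && s (nth t0 r j)) p_bij).
  rewrite (big_nth t0) big_mkord.
  by congr `|_|; apply: eq_bigr => j _; rewrite pE.
rewrite -(key true g gu) (key false f fu) /=.
by congr `|_|; apply: eq_bigr => t _; rewrite mul1r.
Qed.

(** A 1-symmetric sequence is suppression 1-unconditional: a partial sum is the
average of the full sum and of the sum with the signs outside [P] reversed. *)
Lemma norm_sum_restrict (T : Type) (r : seq T) (P : pred T) (a : T -> R)
    (f : T -> nat) : uniq (map f r) ->
  `|\sum_(t <- r | P t) a t *: e (f t)| <= `|\sum_(t <- r) a t *: e (f t)|.
Proof.
move=> fu; set v := \sum_(t <- r) _.
pose w := \sum_(t <- r) ((-1) ^+ (~~ P t) * a t) *: e (f t).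
have wE : `|w| = `|v| by symmetry; exact: norm_sum_reindex.
have -> : \sum_(t <- r | P t) a t *: e (f t) = 2^-1 *: (v + w).
  rewrite -big_split scaler_sumr [LHS]big_mkcond; apply: eq_bigr => t _ /=.
  rewrite -scalerDl scalerA; case: (P t) => /=; last first.
    by rewrite expr1 mulN1r subrr mulr0 scale0r.
  by congr (_ *: _); rewrite expr0 mul1r; lra.
rewrite normrZ ger0_norm ?invr_ge0 // ler_pdivrMl //.
by rewrite (le_trans (ler_normD _ _)) // wE; lra.
Qed.

Lemma norm_term i : `|e i| = `|e 0%N|.
Proof.
have := @norm_sum_reindex unit [:: tt] (fun=> 1) (fun=> false)
  (fun=> i) (fun=> 0%N) isT isT.
by rewrite !big_seq1 expr0 mulr1 !scale1r.
Qed.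

Lemma norm_sum_injective (f : nat -> nat) (a : nat -> R) m n : injective f ->
  `|\sum_(m <= j < n) a j *: e (f j)| = `|\sum_(m <= j < n) a j *: e j|.
Proof.
move=> f_inj; have := @norm_sum_reindex nat (index_iota m n) a
  (fun=> false) f id.
rewrite map_inj_uniq // map_id iota_uniq => /(_ isT isT) ->.
by congr `|_|; apply: eq_bigr => j _; rewrite expr0 mul1r.
Qed.

(** The case of [norm_sum_reindex] in which the index set is the region j < N i
under a family of row lengths; the signs are constant on rows because this is
how they enter when whole copies of a profile change sign. *)
Lemma norm_double_sum_reindex (n : nat) (N : 'I_n -> nat)
    (a : 'I_n -> nat -> R) (s : 'I_n -> bool) (f g : 'I_n -> nat -> nat) :
  (forall i j i' j', (j < N i)%N -> (j' < N i')%N ->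
     f i j = f i' j' -> (i, j) = (i', j')) ->
  (forall i j i' j', (j < N i)%N -> (j' < N i')%N ->
     g i j = g i' j' -> (i, j) = (i', j')) ->
  `|\sum_(i < n) \sum_(0 <= j < N i) a i j *: e (f i j)|
  = `|\sum_(i < n) \sum_(0 <= j < N i) ((-1) ^+ s i * a i j) *: e (g i j)|.
Proof.
move=> f_inj g_inj.
pose r := [seq (i, j) | i <- enum 'I_n, j <- index_iota 0 (N i)].
have ru : uniq r.
  apply: allpairs_uniq_dep; first exact: enum_uniq.
    by move=> i _; exact: iota_uniq.
  by move=> [i j] [i' j'] _ _ /= [-> ->].
have rP p : (p \in r) -> (p.2 < N p.1)%N.
  case/allpairsPdep => i [j [_ + ->]] /=; by rewrite mem_index_iota.
have r_inj h : (forall i j i' j', (j < N i)%N -> (j' < N i')%N ->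
     h i j = h i' j' -> (i, j) = (i', j')) ->
    uniq (map (fun p : 'I_n * nat => h p.1 p.2) r).
  move=> h_inj; rewrite map_inj_in_uniq // => -[i j] [i' j'] /rP/= + /rP/=.
  exact: h_inj.
have := @norm_sum_reindex _ r (fun p => a p.1 p.2)
  (fun p => s p.1) _ _ (r_inj _ f f_inj) (r_inj _ g g_inj).
by rewrite !big_allpairs_dep /= !big_enum.
Qed.

End SymmetricSequences.

(** * Coordinates with respect to a symmetric basis *)

Section SymmetricBasis.
Context (R : realType) (X : normedModType R) (e : nat -> X).
Hypotheses (e_basis : schauder_basis e) (e_sym : one_symmetric e).

Lemma coordinatesP x : is_expansion e x (coordinates e x).
Proof. by have [a [ax _]] := e_basis x; exact: (xgetPex _ (ex_intro _ a ax)). Qed.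

Lemma coordinates_eq x a : is_expansion e x a -> coordinates e x = a.
Proof.
move=> xa; have [b [_ bu]] := e_basis x.
by rewrite -(bu _ xa); apply/esym/bu/coordinatesP.
Qed.

Lemma coordinates_inj x y : coordinates e x = coordinates e y -> x = y.
Proof.
move=> xy; apply: (cvg_unique _ (@coordinatesP x)); first exact: norm_hausdorff.
by rewrite xy; exact: coordinatesP.
Qed.

Lemma coordinatesD x y :
  coordinates e (x + y) = fun k => coordinates e x k + coordinates e y k.
Proof.
apply: coordinates_eq; rewrite /is_expansion.
have -> : series (fun i => (coordinates e x i + coordinates e y i) *: e i)
  = series (fun i => coordinates e x i *: e i)
    + series (fun i => coordinates e y i *: e i).
  apply/funext => n; rewrite /series /= fctE -big_split.
  by apply: eq_bigr => i _; rewrite scalerDl.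
by apply: cvgD; exact: coordinatesP.
Qed.

Lemma coordinatesZ c x :
  coordinates e (c *: x) = fun k => c * coordinates e x k.
Proof.
apply: coordinates_eq; rewrite /is_expansion.
have -> : series (fun i => (c * coordinates e x i) *: e i)
  = c \*: series (fun i => coordinates e x i *: e i).
  apply/funext => n; rewrite /series /= scaler_sumr.
  by apply: eq_bigr => i _; rewrite scalerA.
by apply: cvgZr; exact: coordinatesP.
Qed.

Lemma coordinates_basis i : coordinates e (e i) = fun k => (k == i)%:R.
Proof.
apply: coordinates_eq; apply: cvg_near_cst.
near=> n; rewrite /series /= big_mkord.
have ni : (i < n)%N by near: n; exact: nbhs_infty_gt.
rewrite (bigD1 (Ordinal ni)) //= eqxx scale1r big1 ?addr0 // => j ji.
by rewrite (_ : (j == i :> nat) = false) ?scale0r //; exact: negbTE.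
Unshelve. all: by end_near. Qed.

Lemma coordinates_sum (T : Type) (r : seq T) (a : T -> R) (f : T -> nat) k :
  coordinates e (\sum_(t <- r) a t *: e (f t)) k
  = \sum_(t <- r) a t * (k == f t)%:R.
Proof.
elim: r => [|t r IH]; last first.
  by rewrite !big_cons coordinatesD IH coordinatesZ coordinates_basis.
by rewrite !big_nil -(scale0r (e 0%N)) coordinatesZ mul0r.
Qed.

Lemma coordinates_sub_sum (r : seq nat) (a : nat -> R) k : uniq r ->
  coordinates e (\sum_(i <- r) a i *: e i) k = if k \in r then a k else 0.
Proof.
move=> ru; rewrite (coordinates_sum _ _ id); case: ifPn => kr.
  rewrite (bigD1_seq k) //= eqxx mulr1 big1 ?addr0 // => j /negPf jk.
  by rewrite eq_sym jk mulr0.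
rewrite big_seq big1 // => i ir.
by rewrite (_ : (k == i) = false) ?mulr0 //; apply: contraNF kr => /eqP ->.
Qed.

Lemma basis_neq0 i : e i != 0.
Proof.
apply/eqP => ei0; have := congr1 (@^~ i) (coordinates_basis i).
rewrite /= eqxx ei0 -(scale0r (e 0%N)) coordinatesZ mul0r => /esym/eqP.
by rewrite oner_eq0.
Qed.

Lemma norm_basis_gt0 : 0 < `|e 0%N|.
Proof. by rewrite normr_gt0 basis_neq0. Qed.

(** Continuity of the coordinate functionals comes from symmetry rather than from
a Baire category argument: by unconditionality a single term of the expansion
has norm at most that of every later partial sum. *)
Lemma coordinates_le_norm x k : `|coordinates e x k| * `|e 0%N| <= `|x|.
Proof.
have xcvg : `|series (fun i => coordinates e x i *: e i) n| @[n --> \oo]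
  --> `|x| by exact: cvg_norm (@coordinatesP x).
pose c := `|coordinates e x k| * `|e 0%N|.
have ccvg : (fun=> c) @ \oo --> c by exact: cvg_cst.
apply: (ler_cvg_to ccvg xcvg).
near=> n; have nk : (k < n)%N by near: n; exact: nbhs_infty_gt.
rewrite /c -(norm_term e_sym k) -normrZ.
have := @norm_sum_restrict _ _ e e_sym nat (index_iota 0 n) (pred1 k)
  (coordinates e x) id.
rewrite map_id iota_uniq => /(_ isT).
by rewrite -big_filter filter_pred1_uniq ?iota_uniq ?mem_index_iota // big_seq1.
Unshelve. all: by end_near. Qed.

Lemma coordinates_cvg (T : Type) (F : set_system T) {FF : Filter F}
    (v : T -> X) l k :
  v t @[t --> F] --> l -> coordinates e (v t) k @[t --> F] --> coordinates e l k.
Proof.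
move=> vl; apply/cvgrPdist_le => d d0.
have E0 := norm_basis_gt0.
have /cvgrPdist_le/(_ (d * `|e 0%N|)) := vl; rewrite mulr_gt0 // => /(_ isT).
apply: filterS => t le_d; rewrite -(ler_pM2r E0); apply: le_trans le_d.
apply: le_trans (coordinates_le_norm _ k).
by rewrite coordinatesD -(scaleN1r (v t)) coordinatesZ mulN1r.
Qed.

Lemma coord_supnorm_le x B :
  (forall i, `|coordinates e x i| <= B) -> coord_supnorm e x <= B.
Proof.
move=> xB; apply: ge_sup; last by move=> _ [i _ <-].
by exists `|coordinates e x 0%N|; exists 0%N.
Qed.

(** The bound by the norm of [x] makes the set of coordinates bounded, so that its
[sup] is not the default value. *)
Lemma coord_supnorm_ge x i : `|coordinates e x i| <= coord_supnorm e x.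
Proof.
apply: ub_le_sup; last by exists i.
exists (`|x| / `|e 0%N|) => _ [j _ <-].
by rewrite ler_pdivlMr ?norm_basis_gt0 // coordinates_le_norm.
Qed.

Lemma support_sum x (r : seq nat) : uniq r ->
  (forall i, coordinates e x i != 0 -> i \in r) ->
  \sum_(i <- r) coordinates e x i *: e i = x.
Proof.
move=> ru xr; apply: coordinates_inj; apply/funext => k.
rewrite coordinates_sub_sum //; case: ifPn => // kr.
by apply/esym/eqP; apply: contraNT kr; exact: xr.
Qed.

End SymmetricBasis.

(** * Decreasing rearrangements of finitely supported vectors *)

Section Rearrangement.
Context (R : realType) (X : normedModType R) (e : nat -> X).
Hypotheses (e_basis : schauder_basis e) (e_sym : one_symmetric e).

Lemma decreasing_support x : finite_set (supp e x) ->
  exists r : seq nat, [/\ uniq r,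
    forall i, (i \in r) = (coordinates e x i != 0)
    & sorted (fun i j => `|coordinates e x j| <= `|coordinates e x i|) r].
Proof.
move=> /finite_seqP[r0 r0E].
pose leT i j := `|coordinates e x j| <= `|coordinates e x i|.
exists (sort leT (undup r0)); split.
- by rewrite sort_uniq undup_uniq.
- move=> i; rewrite mem_sort mem_undup; apply/idP/idP => [ir|xi].
    by have : supp e x i by rewrite r0E.
  by have : [set` r0] i by rewrite -r0E.
- by apply: sort_sorted => i j; rewrite /leT le_total.
Qed.

(** With [r] from [decreasing_support] this is the decreasing rearrangement of
[x]; the signs of the coordinates are kept. *)
Definition listed (x : X) (r : seq nat) (j : nat) : R :=
  nth 0 (map (coordinates e x) r) j.

Lemma listed_nth x r j : (j < size r)%N ->
  listed x r j = coordinates e x (nth 0%N r j).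
Proof. exact: nth_map. Qed.

Lemma listed_decr x r i j :
  sorted (fun i j => `|coordinates e x j| <= `|coordinates e x i|) r ->
  (i <= j)%N -> `|listed x r j| <= `|listed x r i|.
Proof.
move=> r_sorted ij; have [jr|rj] := ltnP j (size r); last first.
  by rewrite {1}/listed nth_default ?size_map // normr0.
rewrite !listed_nth ?(leq_ltn_trans ij) //.
apply: (sorted_leq_nth _ _ 0%N r_sorted); rewrite ?inE ?(leq_ltn_trans ij) //.
by move=> k l n lk nl; exact: le_trans nl lk.
Qed.

(** The terms of index at least [size r] vanish, so cutting the rearrangement at
[m] is the same as summing over [take m r]. *)
Lemma listed_sum_take (V : lmodType R) x r m (v : nat -> V) :
  \sum_(0 <= j < m) listed x r j *: v j
  = \sum_(0 <= j < size (take m r)) coordinates e x (nth 0%N r j) *: v j.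
Proof.
have le_m : (size (take m r) <= m)%N by rewrite size_take_min geq_minl.
rewrite (big_cat_nat (leq0n _) le_m) /= [X in _ + X]big_nat_cond [X in _ + X]big1 ?addr0.
  apply: eq_big_nat => j; rewrite size_take_min leq_min => /and3P[_ _ jr].
  by rewrite listed_nth.
move=> j; rewrite andbT size_take_min geq_min => /andP[rj jm].
rewrite /listed nth_default ?scale0r // size_map.
by case/orP: rj => //; rewrite leqNgt jm.
Qed.

Lemma sum_take_nth x r m :
  \sum_(i <- take m r) coordinates e x i *: e i
  = \sum_(0 <= j < size (take m r))
      coordinates e x (nth 0%N r j) *: e (nth 0%N r j).
Proof.
rewrite (big_nth 0%N); apply: eq_big_nat => j /andP[_ jm]; rewrite nth_take //.
by rewrite (leq_trans jm) // size_take_min geq_minl.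
Qed.

Lemma norm_sum_take_le x r m : uniq r ->
  `|\sum_(i <- take m r) coordinates e x i *: e i|
  <= `|\sum_(i <- r) coordinates e x i *: e i|.
Proof.
move=> ru; have := @norm_sum_restrict _ _ e e_sym nat r (mem (take m r))
  (coordinates e x) id.
rewrite map_id => /(_ ru); congr (`|_| <= _).
rewrite -big_filter; congr bigop.
rewrite -{2}[r](cat_take_drop m) filter_cat.
rewrite (all_filterP _); last by apply/allP => i.
have -> : [seq i <- drop m r | mem (take m r) i] = [::]; last by rewrite cats0.
apply/eqP; rewrite -[_ == _]negbK -has_filter; apply/hasPn => i ir.
move: ru; rewrite -{1}[r](cat_take_drop m) cat_uniq => /and3P[_ /hasPn + _].
by apply.
Qed.

(** The left-hand sum is a restriction of [x], moved to the first positions. *)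
Lemma norm_listed_sum_le x r m : uniq r ->
  (forall i, coordinates e x i != 0 -> i \in r) ->
  `|\sum_(0 <= j < m) listed x r j *: e j| <= `|x|.
Proof.
move=> ru xr; rewrite -{2}(support_sum e_basis ru xr).
apply: le_trans (norm_sum_take_le x m ru).
rewrite listed_sum_take sum_take_nth.
rewrite (@norm_sum_reindex _ _ e e_sym nat (index_iota 0 (size (take m r)))
  (fun j => coordinates e x (nth 0%N r j)) (fun=> false) id (nth 0%N r)).
- by under eq_bigr do rewrite mul1r.
- by rewrite map_id iota_uniq.
- rewrite map_inj_in_uniq ?iota_uniq // => i j.
  rewrite !mem_index_iota size_take_min !leq_min => /and3P[_ _ ir] /and3P[_ _ jr].
  by move/eqP; rewrite nth_uniq // => /eqP.
Qed.

End Rearrangement.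

(** Vectors supported on the pairwise disjoint lists [r i] can be truncated and
moved simultaneously, each to its own row of the array [F], without changing the
norm of their combinations. *)
Lemma norm_block_combination (R : realType) (X : normedModType R) (e : nat -> X)
    (e_sym : one_symmetric e) (n : nat) (x : 'I_n -> X) (r : 'I_n -> seq nat)
    (m : 'I_n -> nat) (t : 'I_n -> R) (F : nat -> nat -> nat) :
  (forall i, uniq (r i)) ->
  (forall i i' k, k \in r i -> k \in r i' -> i = i') ->
  (forall i j i' j', F i j = F i' j' -> (i, j) = (i', j')) ->
  `|\sum_(i < n) t i *:
      \sum_(k <- take (m i) (r i)) coordinates e (x i) k *: e k|
  = `|\sum_(i < n) t i *:
      \sum_(0 <= j < m i) listed e (x i) (r i) j *: e (F i j)|.
Proof.
move=> ru r_disj F_inj.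
pose N i := size (take (m i) (r i)).
pose a i j := t i * coordinates e (x i) (nth 0%N (r i) j).
transitivity `|\sum_(i < n) \sum_(0 <= j < N i) a i j *: e (nth 0%N (r i) j)|.
  congr `|_|; apply: eq_bigr => i _; rewrite sum_take_nth scaler_sumr.
  by apply: eq_bigr => j _; rewrite scalerA.
rewrite (@norm_double_sum_reindex _ _ e e_sym n N a (fun=> false)
  (fun i j => nth 0%N (r i) j) (fun i j => F i j)).
- congr `|_|; apply: eq_bigr => i _.
  rewrite (listed_sum_take e (x i) (r i) (m i) (fun j => e (F i j))) scaler_sumr.
  by apply: eq_bigr => j _; rewrite mul1r scalerA.
- have N_le i j : (j < N i)%N -> (j < size (r i))%N.
    by rewrite /N size_take_min leq_min => /andP[].
  move=> i j i' j' /N_le jr /N_le jr' ijE.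
  have ii' : i = i'.
    by apply: (r_disj _ _ (nth 0%N (r i) j)); rewrite ?mem_nth // ijE mem_nth.
  move: ijE jr'; rewrite -ii' => /eqP + jr'.
  by rewrite nth_uniq // => /eqP ->.
- by move=> i j i' j' _ _ /F_inj[ii' ->]; congr (_, _); exact: val_inj.
Qed.

(** * Copies of a profile on infinite sets of positions *)

Lemma series_tail_le (R : realType) (X : normedModType R) (u : nat -> X)
    (t : R) : cvgn (series u) -> 0 < t ->
  exists m, forall n, (m <= n)%N -> `|\sum_(m <= j < n) u j| <= t.
Proof.
move=> /cvg_cauchy/cauchy_seriesP u_cauchy t0.
have [[A B] /= [[a _ aA] [b _ bB]] AB] := u_cauchy t t0.
exists (maxn a b) => n abn; apply: ltW; apply: (AB (maxn a b, n)); split => /=.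
  by apply: aA; rewrite /= leq_maxl.
by apply: bB; rewrite /= (leq_trans (leq_maxr a b)).
Qed.

Section Spread.
Context (R : realType) (X : completeNormedModType R) (e : nat -> X).
Hypotheses (e_basis : schauder_basis e) (e_sym : one_symmetric e).

Definition spread (f : nat -> nat) (b : nat -> R) : X :=
  limn (series (fun j => b j *: e (f j))).

Variable b : nat -> R.
Hypothesis b_cvg : cvgn (series (fun j => b j *: e j)).

(** By symmetry the blocks of this series have the same norms as those of the
series of [b], so it is Cauchy. *)
Lemma spreadP (f : nat -> nat) : injective f ->
  series (fun j => b j *: e (f j)) @ \oo --> spread f b.
Proof.
move=> f_inj; apply: cauchy_cvg; apply/cauchy_seriesP => d d0.
have /cvg_cauchy/cauchy_seriesP/(_ d d0) := b_cvg.
by apply: filterS => -[m n] /=; rewrite (norm_sum_injective e_sym _ _ _ f_inj).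
Qed.

Lemma coordinates_spread f k : injective f ->
  \sum_(0 <= j < n) b j * (k == f j)%:R @[n --> \oo]
  --> coordinates e (spread f b) k.
Proof.
move=> f_inj; have := coordinates_cvg e_basis e_sym (k := k) (spreadP f_inj).
under eq_fun do rewrite /series /= (coordinates_sum e_basis).
exact.
Qed.

Lemma coordinates_spread_in f j : injective f ->
  coordinates e (spread f b) (f j) = b j.
Proof.
move=> f_inj; apply: (cvg_unique _ (coordinates_spread (k := f j) f_inj)).
  exact: norm_hausdorff.
apply: cvg_near_cst; near=> n; have jn : (j < n)%N.
  by near: n; exact: nbhs_infty_gt.
rewrite (bigD1_seq j) ?mem_index_iota ?iota_uniq //= eqxx mulr1 big1 ?addr0 //.
move=> i ij; rewrite (_ : (f j == f i) = false) ?mulr0 //.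
by apply: contraNF ij => /eqP/f_inj ->.
Unshelve. all: by end_near. Qed.

Lemma coordinates_spread_out f k : injective f -> (forall j, k != f j) ->
  coordinates e (spread f b) k = 0.
Proof.
move=> f_inj kf; apply: (cvg_unique _ (coordinates_spread (k := k) f_inj)).
  exact: norm_hausdorff.
apply: cvg_near_cst; apply: nearW => n; rewrite big1 // => j _.
by rewrite (negPf (kf j)) mulr0.
Qed.

Lemma coord_supnorm_spread f : injective f ->
  (forall j, `|b j| <= `|b 0%N|) -> coord_supnorm e (spread f b) = `|b 0%N|.
Proof.
move=> f_inj b_max; apply/le_anti/andP; split.
  apply: coord_supnorm_le => k; have [[j ->]|kf] := pselect (exists j, k = f j).
    by rewrite coordinates_spread_in.
  rewrite coordinates_spread_out ?normr0 // => j.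
  by apply/eqP => kj; apply: kf; exists j.
by rewrite -(coordinates_spread_in 0%N f_inj); exact: coord_supnorm_ge.
Qed.

(** The first [m] terms contribute at most [d * `|e 0|] each, and the tail of the
copy has the norm of the corresponding tail of [b]. *)
Lemma dist_spread_le f (a : nat -> R) m d t : injective f ->
  (forall j, (j < m)%N -> `|b j - a j| <= d) ->
  (forall n, (m <= n)%N -> `|\sum_(m <= j < n) b j *: e j| <= t) ->
  `|\sum_(0 <= j < m) a j *: e (f j) - spread f b| <= m%:R * d * `|e 0%N| + t.
Proof.
move=> f_inj bad bt.
set v := \sum_(0 <= j < m) a j *: e (f j).
have vcvg : `|v - series (fun j => b j *: e (f j)) n| @[n --> \oo]
    --> `|v - spread f b|.
  apply: cvg_norm; apply: cvgB; first exact: cvg_cst.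
  exact: spreadP.
pose c := m%:R * d * `|e 0%N| + t.
have ccvg : (fun=> c) @ \oo --> c by exact: cvg_cst.
apply: (ler_cvg_to vcvg ccvg).
near=> n; have mn : (m <= n)%N by near: n; exact: nbhs_infty_ge.
rewrite /series /= (big_cat_nat (leq0n m) mn) //= opprD addrA.
rewrite /v -sumrB (le_trans (ler_normB _ _)) // (norm_sum_injective e_sym _ _ _ f_inj).
rewrite lerD ?bt // (le_trans (ler_norm_sum _ _ _)) //.
have -> : m%:R * d * `|e 0%N| = \sum_(0 <= j < m) d * `|e 0%N|.
  by rewrite sumr_const_nat subn0 -[RHS]mulr_natl mulrA.
rewrite !big_mkord; apply: ler_sum => j _.
rewrite -scalerBl normrZ (norm_term e_sym) ler_wpM2r // distrC.
exact: bad.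
Unshelve. all: by end_near. Qed.

(** For each truncation of the copies at [N] this is symmetry of [e] applied to
the first [N] entries of finitely many rows; then let [N] tend to infinity. *)
Lemma spread_one_symmetric (F : nat -> nat -> nat) :
  (forall i j i' j', F i j = F i' j' -> (i, j) = (i', j')) ->
  one_symmetric (fun i => spread (F i) b).
Proof.
move=> F_inj n a s p p_bij.
have Fi_inj i : injective (F i) by move=> j j' /F_inj[].
have sum_cvg (t : nat -> R) (q : nat -> nat) :
    `|\sum_(i < n) \sum_(0 <= j < N) (t i * b j) *: e (F (q i) j)|
      @[N --> \oo] --> `|\sum_(i < n) t i *: spread (F (q i)) b|.
  apply: cvg_norm; apply: cvg_big; first exact: add_continuous.
  move=> i _; under eq_fun do under eq_bigr do rewrite -scalerA.
  under eq_fun do rewrite -scaler_sumr.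
  by apply: cvgZr; exact: spreadP.
apply: (cvg_unique _ (sum_cvg a id)); first exact: norm_hausdorff.
have := sum_cvg (fun i => (-1) ^+ s i * a i) p.
rewrite (_ : (fun N => _) = (fun N =>
  `|\sum_(i < n) \sum_(0 <= j < N) (a i * b j) *: e (F i j)|)) //.
apply/funext => N /=.
rewrite (@norm_double_sum_reindex _ _ e e_sym n (fun=> N)
  (fun i j => a i * b j) (fun i => s i) (fun i j => F i j)
  (fun i j => F (p i) j)).
- congr `|_|; apply: eq_bigr => i _; apply: eq_bigr => j _.
  by rewrite mulrA.
- by move=> i j i' j' _ _ /F_inj[ii' ->]; congr (_, _); exact: val_inj.
- move=> i j i' j' _ _ /F_inj[/(bij_inj p_bij) ii' ->]; congr (_, _).
  exact: val_inj.
Qed.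

End Spread.

(** * The limit profile and the decomposition *)

(** The partial sums of [b] have norm at most 2: over the first [m] indices [b] is
so close to some [c n] that the difference has norm at most 1.  The two
statements on absolute values pass to the limit from [c]. *)
Lemma exists_limit_profile (R : realType) (X : normedModType R) (e : nat -> X)
    (e_basis : schauder_basis e) (e_sym : one_symmetric e)
    (e_bc : boundedly_complete e) (c : nat -> nat -> R) (eps : R) :
  (forall n m, `|\sum_(0 <= j < m) c n j *: e j| <= 1) ->
  (forall n i j, (i <= j)%N -> `|c n j| <= `|c n i|) ->
  0 < eps -> (forall n, eps <= `|c n 0%N|) ->
  exists b : nat -> R,
  [/\ forall (d : R) (m N : nat), 0 < d ->
        exists n, (N <= n)%N /\ forall j, (j < m)%N -> `|b j - c n j| <= d,
      cvgn (series (fun j => b j *: e j)),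
      forall j, `|b j| <= `|b 0%N| & 0 < `|b 0%N|].
Proof.
move=> c_norm c_decr eps0 c_large; have E0 := norm_basis_gt0 e_basis.
have c_bounded n j : `|c n j| <= 1 / `|e 0%N|.
  apply: le_trans (c_decr n 0%N j isT) _.
  rewrite ler_pdivlMr // -normrZ.
  by have := c_norm n 1%N; rewrite big_nat1.
have [b bP] := pointwise_bounded_cluster c_bounded.
exists b; split=> //.
- apply: e_bc; exists 2 => m; rewrite /series /=.
  pose d := (m.+1%:R * `|e 0%N|)^-1.
  have d0 : 0 < d by rewrite invr_gt0 mulr_gt0.
  have [n [_ bc]] := bP d m 0%N d0.
  have -> : \sum_(0 <= j < m) b j *: e j = \sum_(0 <= j < m) (b j - c n j) *: e j
      + \sum_(0 <= j < m) c n j *: e j.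
    by rewrite -big_split; apply: eq_bigr => j _ /=; rewrite -scalerDl subrK.
  rewrite (le_trans (ler_normD _ _)) // [2]/(1 + 1) lerD //.
  rewrite (le_trans (ler_norm_sum _ _ _)) //.
  have le_d : \sum_(0 <= j < m) `|(b j - c n j) *: e j|
      <= \sum_(0 <= j < m) d * `|e 0%N|.
    rewrite !big_mkord; apply: ler_sum => j _.
    by rewrite normrZ (norm_term e_sym) ler_wpM2r // bc.
  apply: le_trans le_d _; rewrite sumr_const_nat subn0 /d invfM divfK ?gt_eqF //.
  by rewrite -[X in X <= _]mulr_natl ler_pdivrMr ?ltr0n // mul1r ler_nat.
- move=> j; apply/ler_addgt0Pr => d d0.
  have d20 : 0 < d / 2 by rewrite divr_gt0.
  have [n [_ bc]] := bP _ j.+1 0%N d20.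
  have := bc j (ltnSn j); have := bc 0%N isT; have := c_decr n 0%N j isT.
  have := ler_normD (b j - c n j) (c n j); rewrite subrK.
  have := ler_normB (b 0%N) (b 0%N - c n 0%N); rewrite subKr.
  lra.
- have eps20 : 0 < eps / 2 by rewrite divr_gt0.
  have [n [_ bc]] := bP _ 1%N 0%N eps20.
  have := bc 0%N isT; have := c_large n.
  have := ler_normB (b 0%N) (b 0%N - c n 0%N); rewrite subKr.
  lra.
Qed.

Theorem proposition4p1 (R : realType) (X : completeNormedModType R)
    (e : nat -> X) (e_basis : schauder_basis e) (e_sym : one_symmetric e)
    (e_bc : boundedly_complete e)
    (x : nat -> X) (x_block : block_sequence e x)
    (x_normalized : forall n, `|x n| = 1)
    (eps : R) (eps_gt0 : 0 < eps)
    (x_large : forall n, eps < coord_supnorm e (x n)) :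
  exists phi : nat -> nat, (forall n m, (n < m)%N -> (phi n < phi m)%N) /\
  exists y z u : nat -> X,
    [/\ block_sequence e y, block_sequence e z,
        disjointly_supported e u & one_symmetric u] /\
    [/\ (forall n, x (phi n) = y n + z n) /\
        (forall n m, supp e (y n) `&` supp e (z m) = set0),
        (fun n => coord_supnorm e (z n)) @ \oo --> (0 : R),
        generates_spreading_model y u
      & forall n, coord_supnorm e (u n) = coord_supnorm e (u 0%N) /\
                  0 < coord_supnorm e (u 0%N)].
Proof.
have [x_finite x_succ] := x_block; have E0 := norm_basis_gt0 e_basis.
have [r rP] := choice (fun n => decreasing_support (x_finite n)).
have r_uniq n : uniq (r n) by have [] := rP n.
have r_mem n i : (i \in r n) = (coordinates e (x n) i != 0) by have [] := rP n.
have r_sorted n : sorted (fun i j =>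
  `|coordinates e (x n) j| <= `|coordinates e (x n) i|) (r n) by have [] := rP n.
pose c n := listed e (x n) (r n).
have c_decr n i j : (i <= j)%N -> `|c n j| <= `|c n i| by exact: listed_decr.
have coord_le n i : `|coordinates e (x n) i| <= `|c n 0%N|.
  have [xi0|] := eqVneq (coordinates e (x n) i) 0; first by rewrite xi0 normr0.
  rewrite -r_mem => ir; rewrite -(nth_index 0%N ir) -listed_nth ?index_mem //.
  exact: c_decr.
have c_norm n m : `|\sum_(0 <= j < m) c n j *: e j| <= 1.
  by rewrite -(x_normalized n); apply: norm_listed_sum_le => // i; rewrite r_mem.
have c_large n : eps <= `|c n 0%N|.
  apply: ltW; apply: lt_le_trans (x_large n) _; exact: coord_supnorm_le.
have [b [b_cluster b_cvg b_max b0]] :=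
  exists_limit_profile e_basis e_sym e_bc c_norm c_decr eps_gt0 c_large.
pose eta k : R := (k.+1%:R * k.+1%:R)^-1.
have eta0 k : 0 < eta k by rewrite invr_gt0 mulr_gt0 ?ltr0n.
have [m mP] := choice (fun k => series_tail_le b_cvg (eta0 k)).
(* The bound holds at the index m k as well: there it controls the largest
   coordinate left to z k. *)
have [phi [phi_incr phi_close]] : exists phi : nat -> nat,
    (forall n m, (n < m)%N -> (phi n < phi m)%N) /\
    forall k, forall j, (j < (m k).+1)%N ->
      `|b j - c (phi k) j| <= eta k / (m k).+1%:R.
  apply: (@increasing_selection (fun k n => forall j, (j < (m k).+1)%N ->
      `|b j - c n j| <= eta k / (m k).+1%:R)) => k N.
  by apply: b_cluster; rewrite divr_gt0 ?ltr0n.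
exists phi; split=> //.
pose xi k := coordinates e (x (phi k)).
pose y k := \sum_(i <- take (m k) (r (phi k))) xi k i *: e i.
pose z k := \sum_(i <- drop (m k) (r (phi k))) xi k i *: e i.
pose F (i j : nat) : nat := pickle (i, j).
have F_inj i j i' j' : F i j = F i' j' -> (i, j) = (i', j').
  exact: (pcan_inj pickleK).
have Fi_inj i : injective (F i) by move=> j j' /F_inj[].
pose u i := spread e (F i) b.
have yE k i : coordinates e (y k) i =
    if i \in take (m k) (r (phi k)) then xi k i else 0.
  by rewrite coordinates_sub_sum ?take_uniq.
have zE k i : coordinates e (z k) i =
    if i \in drop (m k) (r (phi k)) then xi k i else 0.
  by rewrite coordinates_sub_sum ?drop_uniq.
have y_supp k i : supp e (y k) i -> i \in take (m k) (r (phi k)).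
  by rewrite /supp /= yE; case: ifP => //; rewrite eqxx.
have z_supp k i : supp e (z k) i -> i \in drop (m k) (r (phi k)).
  by rewrite /supp /= zE; case: ifP => //; rewrite eqxx.
have r_supp k i : i \in r k -> supp e (x k) i by rewrite r_mem.
have sub_block w : (forall k, supp e (w k) `<=` supp e (x (phi k))) ->
    block_sequence e w.
  move=> w_sub; split=> [k|k l kl i j /w_sub xki /w_sub xlj].
    exact: sub_finite_set (w_sub k) (x_finite _).
  exact: x_succ (phi_incr _ _ kl) _ _ xki xlj.
exists y, z, u; split; split.
- by apply: sub_block => k i /y_supp /mem_take /r_supp.
- by apply: sub_block => k i /z_supp /mem_drop /r_supp.
- move=> i i' ii'; rewrite -subset0 => k [].
  have u_supp l : supp e (u l) k -> exists j, k = F l j.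
    move=> kl; apply: contrapT => kF; move/negP: kl; apply.
    rewrite coordinates_spread_out // => j; apply/eqP => kE.
    by apply: kF; exists j.
  by move=> /u_supp[j kE] /u_supp[j']; rewrite kE => /F_inj[].
- exact: spread_one_symmetric.
- split=> [k|k l].
    rewrite /y /z -big_cat cat_take_drop support_sum // => i.
    by rewrite r_mem.
  rewrite -subset0 => i [/y_supp iy /z_supp iz].
  have [kl|kl|kl] := ltngtP k l.
  + have := x_succ _ _ (phi_incr _ _ kl) i i (r_supp _ _ (mem_take iy))
      (r_supp _ _ (mem_drop iz)).
    by rewrite ltnn.
  + have := x_succ _ _ (phi_incr _ _ kl) i i (r_supp _ _ (mem_drop iz))
      (r_supp _ _ (mem_take iy)).
    by rewrite ltnn.
  + subst l; have := r_uniq (phi k); rewrite -(cat_take_drop (m k) (r (phi k))).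
    by rewrite cat_uniq => /and3P[_ /hasPn/(_ _ iz)]; rewrite /= iy.
- pose h k := (`|e 0%N|^-1 + 1) * @harmonic R k.
  apply: (@squeeze_cvgr _ _ _ _ (fun=> 0) h); first last.
  + by rewrite -(mulr0 (`|e 0%N|^-1 + 1)); apply: cvgMr; exact: cvg_harmonic.
  + exact: cvg_cst.
  apply: nearW => k; apply/andP; split.
    exact: le_trans (normr_ge0 _) (coord_supnorm_ge e_basis e_sym (z k) 0%N).
  have eta_le : eta k <= harmonic k.
    rewrite /eta /= invfM ler_piMl ?invr_ge0 ?ler0n //.
    by rewrite invf_le1 ?ltr0n // ler1n.
  apply: (@le_trans _ _ ((`|e 0%N|^-1 + 1) * eta k)); last first.
    by rewrite ler_wpM2l // addr_ge0 ?invr_ge0.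
  apply: coord_supnorm_le => i; rewrite zE; case: ifP => [iz|_]; last first.
    by rewrite normr0 mulr_ge0 ?addr_ge0 ?invr_ge0 // ltW.
  have bm : `|b (m k)| <= `|e 0%N|^-1 * eta k.
    have := mP k (m k).+1 (leqnSn _); rewrite big_nat1 normrZ (norm_term e_sym).
    by move=> b_le; rewrite mulrC ler_pdivlMr.
  have cm : `|xi k i| <= `|c (phi k) (m k)|.
    have := nth_index 0%N iz; rewrite nth_drop => <-.
    have iz' : (index i (drop (m k) (r (phi k))) < size (drop (m k) (r (phi k))))%N.
      by rewrite index_mem.
    rewrite /xi -listed_nth; first by apply: c_decr; exact: leq_addr.
    by move: iz'; rewrite size_drop ltn_subRL.
  have d_le : eta k / (m k).+1%:R <= eta k.
    by rewrite ler_pdivrMr ?ltr0n // ler_peMr ?ler1n // ltW.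
  have bc := le_trans (phi_close k (m k) (ltnSn _)) d_le.
  apply: le_trans cm _; rewrite mulrDl mul1r -[c _ _](subKr (b (m k))).
  exact: le_trans (ler_normB _ _) (lerD bm bc).
- split.
    exists 1 => k; rewrite -(x_normalized (phi k)).
    apply: le_trans (norm_sum_take_le e_sym _ _ (r_uniq _)) _.
    by rewrite support_sum // => i; rewrite r_mem.
  (* The errors add up to at most (`|e 0| + 1) / (n + 1); the constant 2 makes
     the inequality strict. *)
  exists (fun n => (`|e 0%N| + 2) * harmonic n); split.
  + by move=> n; rewrite mulr_gt0 ?addr_gt0 // harmonic_gt0.
  + move=> n k nk; rewrite ler_wpM2l ?addr_ge0 //= lef_pV2 ?posrE ?ltr0n //.
    by rewrite ler_nat.
  + by rewrite -(mulr0 (`|e 0%N| + 2)); apply: cvgMr; exact: cvg_harmonic.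
  move=> n k a k0 k_incr a1.
  have k_ge i : (n <= k i)%N.
    have [->//|i0] := eqVneq i ord0.
    rewrite (leq_trans k0) // ltnW // k_incr // lt0n.
    by apply: contraNneq i0 => i0; apply/eqP/val_inj.
  have k_inj i i' : k i = k i' -> i = i'.
    move=> kE; apply/val_inj; have [ii'|ii'|//] := ltngtP i i'.
      by have := k_incr _ _ ii'; rewrite kE ltnn.
    by have := k_incr _ _ ii'; rewrite kE ltnn.
  have r_disj i i' p : p \in r (phi (k i)) -> p \in r (phi (k i')) -> i = i'.
    move=> /r_supp pi /r_supp pi'; apply: k_inj; have [kk|kk|//] := ltngtP (k i) (k i').
      by have := x_succ _ _ (phi_incr _ _ kk) _ _ pi pi'; rewrite ltnn.
    by have := x_succ _ _ (phi_incr _ _ kk) _ _ pi' pi; rewrite ltnn.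
  rewrite /y /xi (@norm_block_combination _ _ e e_sym n.+1
    (fun i => x (phi (k i))) (fun i => r (phi (k i))) (fun i => m (k i)) a F
    (fun i => r_uniq _) r_disj F_inj).
  apply: le_lt_trans (ler_dist_dist _ _) _.
  rewrite -sumrB; apply: le_lt_trans (ler_norm_sum _ _ _) _.
  have term_le i : `|a i *: (\sum_(0 <= j < m (k i))
        listed e (x (phi (k i))) (r (phi (k i))) j *: e (F i j)) - a i *: u i|
      <= (`|e 0%N| + 1) * eta n.
    rewrite -scalerBr normrZ.
    have := dist_spread_le e_sym b_cvg (@Fi_inj i)
      (fun j jm => phi_close (k i) j (ltnW jm)) (mP (k i)).
    set D := `|_ - _|; have a_le1 : `|a i| <= 1 by rewrite ler_norml.
    move=> D_le; apply: le_trans (ler_piMl (normr_ge0 _) a_le1) _.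
    apply: le_trans D_le _; apply: (@le_trans _ _ ((`|e 0%N| + 1) * eta (k i))).
      rewrite mulrDl mul1r lerD // mulrC ler_wpM2l //.
      rewrite mulrCA ler_piMr ?(ltW (eta0 _)) // ler_pdivrMr ?ltr0n //.
      by rewrite mul1r ler_nat.
    rewrite ler_wpM2l ?addr_ge0 // lef_pV2 ?posrE ?mulr_gt0 ?ltr0n //.
    by rewrite ler_pM ?ler0n // ler_nat ltnS.
  apply: (@le_lt_trans _ _ (\sum_(i < n.+1) (`|e 0%N| + 1) * eta n)).
    exact: ler_sum.
  rewrite sumr_const card_ord -[ltLHS]mulr_natl mulrCA.
  have -> : n.+1%:R * eta n = harmonic n.
    by rewrite /eta /= invfM mulrA mulfV ?mul1r // pnatr_eq0.
  by rewrite ltr_pM2r ?harmonic_gt0 // ltrD2l ltr1n.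
- move=> n; have uE k : coord_supnorm e (u k) = `|b 0%N|.
    exact: coord_supnorm_spread.
  by rewrite !uE.
Qed.
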